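(* Let $X$ be a Banach space with dual $X^*$, let $T : X\rightrightarrows X^*$ be any set-valued map, and let $K:X\rightrightarrows X$ be a set-valued map with nonempty convex values. (a) If $T$ is pseudomonotone (on $X$), then $LMQVI(T,K)\subset MQVI(T,K)$. (b) If $T$ is locally upper sign-continuous on $X$, then $LMQVI(T,K)\subset LSQVI(T,K)$.
   Context: $\langle\cdot,\cdot\rangle$ is the duality pairing on $X^*\times X$. A neighbourhood of a point is any set containing an open set that contains the point. $MQVI(T,K)$: the set of $\bar x\in X$ with $\bar x\in K(\bar x)$ such that $\langle y^*,y-\bar x\rangle\ge 0$ for all $y\in K(\bar x)$ and all $y^*\in T(y)$. $LMQVI(T,K)$: the set of $\bar x\in X$ with $\bar x\in K(\bar x)$ for which there is a neighbourhood $U$ of $\bar x$ such that $\langle y^*,y-\bar x\rangle\ge 0$ for all $y\in K(\bar x)\cap U$ and all $y^*\in T(y)$. $LSQVI(T,K)$: the set of $\bar x\in X$ with $\bar x\in K(\bar x)$ for which there are a neighbourhood $U$ of $\bar x$ and $\bar x^*\in T(\bar x)$ such that $\langle \bar x^*,y-\bar x\rangle\ge 0$ for all $y\in K(\bar x)\cap U$. $T$ is pseudomonotone on $C\subset X$ if for all $x,y\in C$: whenever there is $x^*\in T(x)$ with $\langle x^*,y-x\rangle\ge0$, then $\langle y^*,y-x\rangle\ge 0$ for all $y^*\in T(y)$. A set-valued map $S$ is upper sign-continuous on a convex set $C$ if for all $x,y\in C$, with $x_t:=tx+(1-t)y$: if $\inf_{x_t^*\in S(x_t)}\langle x_t^*,y-x\rangle\ge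 0$ for all $t\in\,]0,1[$, then $\sup_{x^*\in S(x)}\langle x^*,y-x\rangle\ge0$. $T$ is locally upper sign-continuous on a convex set $C$ if for every $x\in C$ there are a convex neighbourhood $V_x$ of $x$ and an upper sign-continuous map $S_x:V_x\cap C\rightrightarrows X^*$ with nonempty, convex, $w^*$-compact values such that $S_x(y)\subset T(y)\setminus\{0\}$ for all $y\in V_x\cap C$.
   Formalization: In part (a), T is additionally assumed to have nonempty values at every point of X; without this (a) fails, e.g. X = R, K(x) = [0,1], T(1) = {-1}, T(y) empty for y ≠ 1, where 0 is in LMQVI but not in MQVI. *)

(* Defs.v *)
From HB Require Import structures.
From mathcomp Require Import all_boot all_order all_algebra.
From mathcomp Require Import all_classical all_reals all_analysis.
Import Order.TTheory GRing.Theory Num.Theory.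
Import numFieldNormedType.Exports.

Set Implicit Arguments.
Unset Strict Implicit.
Unset Printing Implicit Defensive.

Local Open Scope classical_set_scope.
Local Open Scope ring_scope.

Section Dual.
Variables (R : realType) (X : normedModType R).

Definition dual_pred : {pred X -> R^o} :=
  mem [set f : X -> R^o | linear f /\ continuous f].

(* The duality pairing of [f : dual X] and [x : X] is the application [f x]. *)
Record dual := Dual { dual_fun :> X -> R^o ; dual_funP : dual_fun \in dual_pred }.

HB.instance Definition _ := [isSub for dual_fun].
HB.instance Definition _ := [Choice of dual by <:].

Lemma dual_pred_submod : submod_closed dual_pred.
Proof.
split=> [|a f g]; rewrite !inE.
  split=> [b x y|x]; first by rewrite /= scaler0 addr0.
  exact: cst_continuous.
move=> [lf cf] [lg cg]; split=> [b x y|x].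
  rewrite -[LHS]/(a *: f (b *: x + y) + g (b *: x + y)).
  rewrite -[RHS]/(b *: (a *: f x + g x) + (a *: f y + g y)).
  rewrite lf lg !scalerDr !scalerA (mulrC b a) !addrA.
  by congr (_ + _); rewrite -!addrA; congr (_ + _); rewrite addrC.
apply: (@continuousD _ _ _ (a \*: f) g); last exact: cg.
by apply: continuousZl_tmp; exact: cf.
Qed.

HB.instance Definition _ :=
  GRing.isSubmodClosed.Build R (X -> R^o) dual_pred dual_pred_submod.
HB.instance Definition _ := [SubChoice_isSubLmodule of dual by <:].

(* [dual] with the w*-topology, i.e. that of pointwise convergence on [X]. *)
Definition weak_star := initial_topology (dual_fun : dual -> {ptws X -> R^o}).

HB.instance Definition _ := Topological.on weak_star.

End Dual.

Section QVI.
Variables (R : realType) (X : normedModType R).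
Implicit Types (T S : X -> set (dual X)) (K : X -> set X) (C : set X).

Definition MQVI T K : set X :=
  [set xb | K xb xb /\
    forall y, K xb y -> forall ys, T y ys -> 0 <= ys (y - xb)].

Definition LMQVI T K : set X :=
  [set xb | K xb xb /\
    exists2 U, nbhs xb U &
    forall y, (K xb `&` U) y -> forall ys, T y ys -> 0 <= ys (y - xb)].

Definition LSQVI T K : set X :=
  [set xb | K xb xb /\
    exists2 U, nbhs xb U &
    exists2 xs, T xb xs & forall y, (K xb `&` U) y -> 0 <= xs (y - xb)].

Definition pseudomonotone C T :=
  forall x y, C x -> C y ->
    (exists2 xs, T x xs & 0 <= xs (y - x)) ->
    forall ys, T y ys -> 0 <= ys (y - x).

(* [C] is meant to be convex. The infimum and supremum are taken in the
   extended reals, and only the values of [S] on [C] matter, so that a total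
   [S] represents a map defined on [C]. *)
Definition upper_sign_continuous C S :=
  forall x y, C x -> C y ->
    (forall t : R, 0 < t < 1 ->
      (0 <= ereal_inf [set (xs (y - x)%R)%:E | xs in S (t *: x + (1 - t) *: y)%R])%E) ->
    (0 <= ereal_sup [set (xs (y - x)%R)%:E | xs in S x])%E.

Definition locally_upper_sign_continuous C T :=
  forall x, C x ->
    exists V : set X, [/\ nbhs x V, @convex_set R X V &
    exists S, upper_sign_continuous (V `&` C) S /\
      forall y, (V `&` C) y ->
        [/\ S y !=set0, @convex_set R (dual X) (S y),
            @compact (weak_star X) (S y) & S y `<=` T y `\ 0]].

End QVI.

(* Main.v *)
(* (a) A point z close to x on the segment from x to y satisfies the local
   Minty inequality, which is homogeneous along the segment; pseudomonotonicity
   then carries it from z to y.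
   (b) On a convex neighbourhood W of x, the Minty inequality along the segments
   from x and upper sign-continuity give, for each y in K(x) and W, some f in
   S(x) with f(y - x) >= 0. That one f serves every y is a minimax argument.
   Cutting S(x) by {f | f w >= 0} preserves the hypothesis, by the case of two
   vectors v, w, so finitely many y can be served at once, and w*-compactness
   does the rest. In the case of two vectors, if no f is nonnegative on both,
   then comparing the largest ratio of f v to - f w with the largest ratio of
   g w to - g v yields a convex combination of v and w at which every f is
   negative. *)
Require Import Defs.
From HB Require Import structures.
From mathcomp Require Import all_boot all_order all_algebra.
From mathcomp Require finmap.
From mathcomp Require Import all_classical all_reals all_analysis.
From mathcomp Require Import ring lra.
Import Order.TTheory GRing.Theory Num.Theory.
Import numFieldNormedType.Exports.

Local Open Scope classical_set_scope.
Local Open Scope ring_scope.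

Lemma conv_lmodE (R : realType) (M : lmodType R) (x y : M) (l : {i01 R}) :
  conv l (x : convex_lmodType M) y = l%:num *: x + (1 - l%:num) *: y.
Proof. by []. Qed.

Lemma convex_set_comb (R : realType) (M : lmodType R) (A : set M) (x y : M)
    (t : R) : @convex_set R M A -> A x -> A y -> 0 <= t <= 1 ->
  A (t *: x + (1 - t) *: y).
Proof.
move=> cA Ax Ay t01; apply/set_mem.
by apply: (cA x y (Itv01 (andP t01).1 (andP t01).2)); exact: mem_set.
Qed.

Section DualPairing.
Variables (R : realType) (X : normedModType R).
Implicit Types (f g : dual X) (v w : X) (A : set (dual X)) (B : set X).

Lemma dual_linear f : linear f.
Proof. by have := dual_funP f; rewrite inE => -[]. Qed.

Lemma dual_comb f (s t : R) v w : f (s *: v + t *: w) = s * f v + t * f w.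
Proof.
have f0 : f 0 = 0.
  by have := dual_linear f 1 0 0; rewrite scaler0 addr0 scale1r; lra.
rewrite dual_linear; congr (_ + _).
by rewrite -[t *: w]addr0 dual_linear f0 addr0.
Qed.

Lemma dualZ f (t : R) v : f (t *: v) = t * f v.
Proof. by rewrite -[t *: v]addr0 -[0](scale0r v) dual_comb mul0r addr0. Qed.

Lemma dualE f g (s t : R) v : (s *: f + t *: g) v = s * f v + t * g v.
Proof. by []. Qed.

Lemma eval_weak_star_continuous v :
  continuous (fun f : weak_star X => dual_fun f v : R).
Proof.
move=> f; apply: (@continuous_comp (weak_star X) {ptws X -> R^o} R
  (@dual_fun R X) (fun h => h v)); first exact: initial_continuous.
exact: (@proj_continuous X (fun=> R^o) v).
Qed.

Lemma closed_ge0 v : @closed (weak_star X) [set f | 0 <= f v].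
Proof.
apply: (@preimage_closed _ _ (fun f : weak_star X => dual_fun f v : R)
  [set x | 0 <= x]) => [f _|]; last exact: closed_ge.
exact: eval_weak_star_continuous.
Qed.

Lemma compact_ge0 A v : @compact (weak_star X) A ->
  @compact (weak_star X) (A `&` [set f | 0 <= f v]).
Proof. by move=> cA; apply: compact_closedI => //; exact: closed_ge0. Qed.

(** On the cut of [A] by [0 <= f v] the denominator [- f w] is positive, so [f v / - f w] is
    w*-continuous there and compactness gives a maximum [r]. *)
Lemma ge0_max_ratio A v w : @compact (weak_star X) A ->
  (exists2 f, A f & 0 <= f v) -> (forall f, A f -> 0 <= f v -> f w < 0) ->
  exists r, [/\ 0 <= r, exists f, [/\ A f, 0 <= f v & f v = - r * f w] &
    forall f, A f -> 0 <= f v -> f v <= - r * f w].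
Proof.
move=> cA [f0 Af0 f0v] H.
pose A1 := A `&` [set f | 0 <= f v].
have A10 : A1 !=set0 by exists f0.
have [|f] := @compact_EVT_max (weak_star X) R (fun f => f v / - f w) A1 A10
  (compact_ge0 A v cA).
  apply: continuous_in_subspaceT => f /set_mem [Af fv].
  have ev u := eval_weak_star_continuous u f.
  apply: (cvgM (ev v) (cvgV _ (cvgN (ev w)))).
  by rewrite oppr_eq0 lt_eqF// H.
move=> /set_mem [Af fv] fmax.
have fw := H _ Af fv.
exists (f v / - f w); split.
- by rewrite divr_ge0// oppr_ge0 ltW.
- exists f; split=> //; field; lra.
- move=> g Ag gv; have gw := H _ Ag gv.
  have : g v / - g w <= f v / - f w by apply: fmax; exact/mem_set.
  by rewrite ler_pdivrMr ?oppr_gt0// mulrN mulNr.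
Qed.

(* Convexity of [A]: otherwise a segment from a point with [f v >= 0] to one
   with [g w >= 0] would cross the quadrant at the point where [v] vanishes. *)
Lemma ge0_cross A v w f g : @convex_set R (dual X) A ->
  (forall h, A h -> 0 <= h v -> h w < 0) ->
  A f -> 0 <= f v -> A g -> g v < 0 -> f v * g w < f w * g v.
Proof.
move=> cA H Af fv Ag gv; rewrite ltNge; apply/negP => fg.
have d0 : 0 < f v - g v by lra.
pose s := - g v / (f v - g v).
have s1 : 1 - s = f v / (f v - g v) by rewrite /s; field; lra.
have s01 : 0 <= s <= 1.
  have : 0 <= 1 - s by rewrite s1 divr_ge0// ltW.
  have : 0 <= s by rewrite divr_ge0//; lra.
  lra.
have := H _ (convex_set_comb _ _ _ f g s cA Af Ag s01).
rewrite !dualE s1.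
have -> : s * f v + f v / (f v - g v) * g v = 0 by rewrite /s; field; lra.
move=> /(_ (lexx _)); apply/negP; rewrite -leNgt.
have -> : s * f w + f v / (f v - g v) * g w =
    (f v * g w - f w * g v) / (f v - g v) by rewrite /s; field; lra.
by rewrite divr_ge0//; lra.
Qed.

Lemma ge0_pair A v w : @convex_set R (dual X) A -> @compact (weak_star X) A ->
  (forall t : R, 0 <= t <= 1 ->
    exists2 f, A f & 0 <= f (t *: v + (1 - t) *: w)) ->
  exists f, [/\ A f, 0 <= f v & 0 <= f w].
Proof.
move=> convA cA H; apply: contrapT => N.
have Nvw f : A f -> 0 <= f v -> f w < 0.
  by move=> Af fv; rewrite ltNge; apply/negP => fw; apply: N; exists f.
have Nwv f : A f -> 0 <= f w -> f v < 0.
  by move=> Af fw; rewrite ltNge; apply/negP => fv; apply: N; exists f.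
have exv : exists2 f, A f & 0 <= f v.
  have [|f Af] := H 1; first by rewrite ler01 lexx.
  by rewrite dual_comb subrr mul0r addr0 mul1r; exists f.
have exw : exists2 f, A f & 0 <= f w.
  have [|f Af] := H 0; first by rewrite ler01 lexx.
  by rewrite dual_comb subr0 mul0r add0r mul1r; exists f.
have [r [r0 [f [Af fv fr]] rmax]] := ge0_max_ratio A v w cA exv Nvw.
have [q [q0 [g [Ag gw gq]] qmax]] := ge0_max_ratio A w v cA exw Nwv.
have fw := Nvw f Af fv; have gv := Nwv g Ag gw.
(* Substituting the two extremal ratios into [ge0_cross] gives [r * q * (f w * g v) < f w * g v],
   with [f w * g v] positive. *)
have rq : r * q < 1.
  have := ge0_cross A v w f g convA Nvw Af fv Ag gv.
  rewrite fr gq.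
  have P : 0 < f w * g v :> R by rewrite nmulr_rgt0.
  rewrite (_ : _ * (- q * g v) = r * q * (f w * g v)); last by ring.
  by rewrite -[X in _ < X]mul1r ltr_pM2r.
(* Weights proportional to [1 + q] and [1 + r]: if [0 <= h v], then [h v <= - r * h w] bounds the
   weighted sum by [(1 - r * q) * h w < 0]; symmetrically if [0 <= h w]. *)
have d0 : 0 < 2 + q + r by lra.
have s1 : 1 - (1 + q) / (2 + q + r) = (1 + r) / (2 + q + r) by field; lra.
have [|h Ah] := H ((1 + q) / (2 + q + r)).
  have : 0 <= 1 - (1 + q) / (2 + q + r) by rewrite s1 divr_ge0//; lra.
  have : 0 <= (1 + q) / (2 + q + r) by rewrite divr_ge0//; lra.
  lra.
rewrite dual_comb s1.
have -> : (1 + q) / (2 + q + r) * h v + (1 + r) / (2 + q + r) * h w =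
    ((1 + q) * h v + (1 + r) * h w) / (2 + q + r) by field; lra.
rewrite pmulr_lge0 ?invr_gt0//; apply/negP; rewrite -ltNge.
have [hv|hv] := leP 0 (h v).
  have := rmax h Ah hv; have := Nvw h Ah hv; nra.
have [hw|hw] := leP 0 (h w); last by nra.
have := qmax h Ah hw; nra.
Qed.

Lemma convex_ge0 A v : @convex_set R (dual X) A ->
  @convex_set R (dual X) (A `&` [set f | 0 <= f v]).
Proof.
move=> cA f g l /set_mem [Af fv] /set_mem [Ag gv]; apply/mem_set; split.
  by apply/set_mem; apply: cA; exact/mem_set.
rewrite /= [X in _ <= X](_ : _ = l%:num * f v + (1 - l%:num) * g v)//.
by rewrite addr_ge0// mulr_ge0// subr_ge0.
Qed.

Lemma ge0_finite A B (s : seq X) :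
  @convex_set R (dual X) A -> @compact (weak_star X) A -> @convex_set R X B ->
  B !=set0 -> (forall v, B v -> exists2 f, A f & 0 <= f v) ->
  (forall v, v \in s -> B v) ->
  exists2 f, A f & forall v, v \in s -> 0 <= f v.
Proof.
move=> + + cB [v0 Bv0]; elim: s A => [|w s IH] A convA cA H sB.
  by have [f Af _] := H _ Bv0; exists f.
have Bw : B w by apply: sB; rewrite mem_head.
(* The cut by [w] inherits the hypothesis from [ge0_pair], as the segment from [v] to [w] stays in
   [B]. *)
have [v Bv|v vs|f [Af fw] fs] := IH _ (convex_ge0 A w convA)
    (compact_ge0 A w cA).
- have [t t01|f [Af fv fw]] := ge0_pair A v w convA cA; last by exists f.
  by apply: H; exact: convex_set_comb.
- by apply: sB; rewrite in_cons vs orbT.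
exists f => // v; rewrite in_cons => /predU1P[->//|]; exact: fs.
Qed.

Lemma convex_compact_ge0 A B :
  @convex_set R (dual X) A -> @compact (weak_star X) A -> @convex_set R X B ->
  B !=set0 -> (forall v, B v -> exists2 f, A f & 0 <= f v) ->
  exists2 f, A f & forall v, B v -> 0 <= f v.
Proof.
move=> convA cA cB B0 H; have [v0 Bv0] := B0.
pose F v : set (weak_star X) := A `&` [set f | 0 <= f v].
have FI : finI B F.
  move=> D DB; have [v /DB /set_mem//|f Af fD] :=
    ge0_finite A B (finmap.enum_fset D) convA cA cB B0 H.
  by exists f => v vD; split => //; exact: fD.
(* A cluster point of the filter generated by the [F v] lies in every closed half-space. *)
have [|f [Af fF]] := cA _ (finI_filter FI).
  by exists (F v0); [exact: finI_from1|move=> f []].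
exists f => // v Bv.
apply: closed_ge0 => C; apply: fF.
by exists (F v); [exact: finI_from1|move=> g []].
Qed.

End DualPairing.

(** Part (a) asks for nonempty values: if [T y] is a single [f] with [f (y - x) < 0] and [T] is
    empty elsewhere, then [T] is pseudomonotone, and for [K] constantly [X] the point [x] is a local
    but not a global solution. *)
Theorem proposition3p1 (R : realType) (X : completeNormedModType R)
    (T : X -> set (dual X)) (K : X -> set X)
    (K0 : forall x, K x !=set0) (Kconvex : forall x, @convex_set R X (K x)) :
  ((forall x, T x !=set0) -> pseudomonotone setT T -> LMQVI T K `<=` MQVI T K) /\
  (locally_upper_sign_continuous setT T -> LMQVI T K `<=` LSQVI T K).
Proof.
split=> [T0 pT|lT] x [Kx [U Ux HU]]; split=> //.
  move=> y Ky ys Tys.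
  have near_x : (fun s : R => x + s *: (y - x)) s @[s --> 0] --> x.
    rewrite -[X in _ --> X]addr0 -[X in _ --> _ + X](scale0r (y - x)).
    by apply: cvgD; [exact: cvg_cst|apply: cvgZr_tmp].
  have [e /= e0 He] := (iffLR (nbhs_ballP _ _)) (near_x _ Ux).
  (* [s < e] puts [z] in [U]; [0 < s < 1] makes [z - x] and [y - z] positive multiples of
     [y - x]. *)
  pose s := Num.min (e / 2) (1 / 2).
  have s0 : 0 < s by rewrite lt_min !divr_gt0.
  have s1 : s < 1 by rewrite gt_min; apply/orP; right; lra.
  have se : s < e by rewrite gt_min; apply/orP; left; lra.
  set z := x + s *: (y - x).
  have Uz : U z by apply: He; rewrite /ball /= sub0r normrN gtr0_norm.
  have Kz : K x z.
    have -> : z = s *: y + (1 - s) *: x.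
      by rewrite /z scalerBr scalerBl scale1r addrCA.
    by apply: convex_set_comb => //; rewrite !ltW.
  have [zs Tzs] := T0 z.
  have zsx : 0 <= zs (y - x).
    have := HU z (conj Kz Uz) zs Tzs.
    by rewrite addrC addKr dualZ pmulr_rge0.
  have yzE : y - z = (1 - s) *: (y - x).
    by rewrite /z opprD addrA scalerBl scale1r.
  have := pT z y I I; rewrite yzE => /(_ _ _ Tys).
  rewrite !dualZ pmulr_rge0 ?subr_gt0//; apply.
  by exists zs => //; rewrite dualZ mulr_ge0// subr_ge0 ltW.
have [V [Vx _ [S [uS HS]]]] := lT x I.
(* [U] need not be convex; a convex [W] inside it keeps the segments from [x] where the Minty
   inequality holds. *)
have [bs bs_convex [bs_open bs_nbhs]] := @locally_convex R X.
have [W /= [bsW Wx] WUV] := bs_nbhs x _ (filterI Ux Vx).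
have W_convex := bs_convex W (mem_set bsW).
have Vxx : (V `&` setT) x by split=> //; exact: nbhs_singleton.
have [Sx0 Sx_convex Sx_compact SxT] := HS x Vxx.
pose B := [set v | (K x `&` W) (x + v)].
have [||v [Kv Wv]|f Sf Hf] := convex_compact_ge0 _ _ (S x) B Sx_convex Sx_compact.
- move=> u v l /set_mem [Ku Wu] /set_mem [Kv Wv]; apply/mem_set.
  rewrite /B /=.
  have -> : x + conv l u v = conv l (x + u : convex_lmodType X) (x + v).
    by rewrite !conv_lmodE !scalerDr addrACA -scalerDl subrKC scale1r.
  by split; apply/set_mem; [apply: Kconvex|apply: W_convex]; exact/mem_set.
- by exists 0; rewrite /B /= addr0.
- set y := x + v in Kv Wv.
  have vE : v = y - x by rewrite /y addrC addKr.
  have sup0 : (0 <= ereal_sup [set (xs (y - x))%:E | xs in S x])%E.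
    apply: uS => //; first by split=> //; have [] := WUV y Wv.
    move=> t /andP[t0 t1]; apply: le_ereal_inf_tmp => _ [zs Szs <-].
    set z := t *: x + (1 - t) *: y in Szs.
    have t01 : 0 <= t <= 1 by rewrite !ltW.
    have Kz : K x z by exact: convex_set_comb.
    have Wz : W z by exact: convex_set_comb.
    have [Uz Vz] := WUV z Wz.
    have [_ _ _ ST] := HS z (conj Vz I).
    have [Tzs _] := ST _ Szs.
    have := HU z (conj Kz Uz) zs Tzs.
    have -> : z - x = (1 - t) *: (y - x).
      rewrite /z scalerBr addrAC [RHS]addrC; congr (_ + _).
      by rewrite scalerBl scale1r opprB.
    by rewrite dualZ pmulr_rge0 ?subr_gt0// lee_fin.
  (* By w*-compactness the supremum is attained, so its sign passes to an actual [f] in [S x]. *)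
  have [|f /set_mem Sf fmax] := @compact_EVT_max (weak_star X) R
    (fun f => f v) (S x) Sx0 Sx_compact.
    by apply: continuous_in_subspaceT => f _; exact: eval_weak_star_continuous.
  exists f => //; rewrite -lee_fin; apply: (le_trans sup0).
  apply: ge_ereal_sup => _ [g Sg <-]; rewrite -vE lee_fin.
  by apply: fmax; exact/mem_set.
exists W; first by apply: open_nbhs_nbhs; split => //; exact: bs_open.
have [Tf _] := SxT f Sf.
exists f => // y [Ky Wy]; apply: Hf.
by rewrite /B /= addrC subrK.
Qed.
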